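(* Let $d\ge1$ and let $\nu^\star(\mathrm{d}z,\mathrm{d}x)=\rho^\star(\mathrm{d}z)\,\alpha(\mathrm{d}x)$ be a homogeneous Lévy intensity on $\mathbb{R}^+\times\mathbb{X}$. Consider the $d$-variate compound random measure with directing Lévy measure $\nu^\star$ and with score density given by $d$ independent standard exponential distributions, $$h(s_1,\dots,s_d)=\prod_{i=1}^d e^{-s_i},\qquad s_1,\dots,s_d>0.$$ Each of its marginal intensities is $\nu_j(\mathrm{d}s,\mathrm{d}x)=f(s)\,\mathrm{d}s\,\alpha(\mathrm{d}x)$, where $$f(s)=\int_0^\infty z^{-1}e^{-s/z}\,\rho^\star(\mathrm{d}z),\qquad s>0.$$ Then the $d$-variate Lévy intensity $\tilde\nu_d(\mathrm{d}\boldsymbol{s},\mathrm{d}x)=\tilde\rho_d(\boldsymbol{s})\,\mathrm{d}\boldsymbol{s}\,\alpha(\mathrm{d}x)$ of this compound random measure satisfies, for $\boldsymbol{s}=(s_1,\dots,s_d)\in(\mathbb{R}^+)^d$, $$\tilde\rho_d(\boldsymbol{s})=(-1)^{d-1}\left.\frac{\partial^{d-1}}{\partial s^{d-1}}f(s)\right|_{s=s_1+\dots+s_d}.$$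
   Context: $\mathbb{R}^+=(0,\infty)$. $\mathbb{X}$ is a Polish space (with a fixed complete separable metric, with respect to which ''bounded'' is understood) with Borel $\sigma$-algebra $\mathcal{X}$. A Lévy intensity is a measure $\nu$ on $(\mathbb{R}^+\times\mathbb{X},\mathcal{B}(\mathbb{R}^+)\otimes\mathcal{X})$ such that $\int_{\mathbb{R}^+\times X}\min\{1,s\}\,\nu(\mathrm{d}s,\mathrm{d}x)<\infty$ for every bounded $X\in\mathcal{X}$; it is homogeneous if it is of the form $\rho(\mathrm{d}s)\,\alpha(\mathrm{d}x)$ with $\rho$ a measure on $(\mathbb{R}^+,\mathcal{B}(\mathbb{R}^+))$ and $\alpha$ a measure on $(\mathbb{X},\mathcal{X})$. A compound random measure (CoRM) with score density $h$ (a probability density on $(\mathbb{R}^+)^d$) and directing Lévy measure $\nu^\star$ is a vector of $d$ completely random measures with multivariate Lévy intensity $\tilde\nu_d(\mathrm{d}\boldsymbol{s},\mathrm{d}x)=\int_{\mathbb{R}^+}z^{-d}h(s_1/z,\dots,s_d/z)\,\mathrm{d}\boldsymbol{s}\,\nu^\star(\mathrm{d}z,\mathrm{d}x)$. In the homogeneous case $\tilde\nu_d(\mathrm{d}\boldsymbol{s},\mathrm{d}x)=\tilde\rho_d(\boldsymbol{s})\,\mathrm{d}\boldsymbol{s}\,\alpha(\mathrm{d}x)$ with $\tilde\rho_d(\boldsymbol{s})=\int_0^\infty z^{-d}h(s_1/z,\dots,s_d/z)\,\rho^\star(\mathrm{d}z)$. The $j$-th marginal $\nu_j$ is obtained from $\tilde\nu_d$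 by integrating out all $s_i$, $i\ne j$. *)

(* Defs.v *)
From HB Require Import structures.
From mathcomp Require Import all_boot all_order all_algebra.
From mathcomp Require Import all_classical all_reals all_analysis.

Set Implicit Arguments.
Unset Strict Implicit.
Unset Printing Implicit Defensive.

Import Order.TTheory GRing.Theory Num.Theory.
Import numFieldNormedType.Exports.

Local Open Scope classical_set_scope.
Local Open Scope ring_scope.

HB.mixin Record isSeparable T & Topological T := {
  separable : exists2 D : set T, countable D & dense D
}.

(* The complete separable metric is part of the structure: bounded sets below
   are understood with respect to it. *)
#[short(type="polishType")]
HB.structure Definition Polish (R : numDomainType) :=
  {T of Metric R T & Complete T & isSeparable T}.

Notation borel X := (g_sigma_algebraType (@open X)).

Definition mbounded (R : numDomainType) (X : metricType R) (Y : set X) :=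
  exists r : R, forall x y, Y x -> Y y -> mdist x y <= r.

Section power_measure.
Local Open Scope ereal_scope.
Context {d} {T : measurableType d} {R : realType}.
Variable mu : {sigma_finite_measure set T -> \bar R}.

Section cons_measure.
Variables (n : nat) (m : {sigma_finite_measure set (n.-tuple T) -> \bar R}).

Let tcons (p : T * n.-tuple T) : n.+1.-tuple T := [tuple of p.1 :: p.2].

Let mtcons : measurable_fun [set: T * n.-tuple T] tcons.
Proof. exact: measurable_cons. Qed.

Definition cons_measure : set (n.+1.-tuple T) -> \bar R :=
  pushforward (mu \x m) tcons.

Let cons_measure0 : cons_measure set0 = 0.
Proof. by rewrite /cons_measure /pushforward preimage_set0 measure0. Qed.

Let cons_measure_ge0 A : 0 <= cons_measure A.
Proof. exact: measure_ge0. Qed.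

Let cons_measure_sigma_additive : semi_sigma_additive cons_measure.
Proof.
move=> F mF tF mUF; rewrite /cons_measure /pushforward preimage_bigcup.
apply: measure_semi_sigma_additive.
- by move=> k; rewrite -[X in measurable X]setTI; exact: mtcons.
- apply/trivIsetP => /= i j _ _ ij; rewrite -preimage_setI.
  by move/trivIsetP : tF => /(_ _ _ _ _ ij) ->//; rewrite preimage_set0.
- by rewrite -preimage_bigcup -[X in measurable X]setTI; exact: mtcons.
Qed.

HB.instance Definition _ := isMeasure.Build _ _ _ cons_measure
  cons_measure0 cons_measure_ge0 cons_measure_sigma_additive.

Let cons_measure_sigma_finite : sigma_finite setT cons_measure.
Proof.
have /sigma_finiteP[F [TF ndF Foo]] := sigma_finiteT mu.
have /sigma_finiteP[G [TG ndG Goo]] := sigma_finiteT m.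
pose t (v : n.+1.-tuple T) : n.-tuple T := [tuple of behead v].
have mt0 : measurable_fun setT (fun v : n.+1.-tuple T => thead v).
  exact: measurable_tnth.
have mt : measurable_fun setT t by exact: measurable_behead.
exists (fun k => [set v | F k (thead v)] `&` [set v | G k (t v)]).
  rewrite predeqE => v; split=> // _.
  have [i _ Fi] : (\bigcup_i F i) (thead v) by rewrite -TF.
  have [j _ Gj] : (\bigcup_i G i) (t v) by rewrite -TG.
  exists (maxn i j) => //; split => /=.
  - by move: Fi; exact/subsetPset/ndF/leq_maxl.
  - by move: Gj; exact/subsetPset/ndG/leq_maxr.
move=> k; have [mF Fk] := Foo k; have [mG Gk] := Goo k; split.
  by apply: measurableI; rewrite -[X in measurable X]setTI; [exact: mt0|exact: mt].
rewrite /cons_measure /pushforward.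
rewrite (_ : _ @^-1` _ = F k `*` G k); last first.
  rewrite predeqE => -[x v]; rewrite /= theadE.
  by rewrite (_ : t _ = v)//; exact: val_inj.
by rewrite product_measure1E// lte_mul_pinfty// ge0_fin_numE.
Qed.

HB.instance Definition _ := Measure_isSigmaFinite.Build _ _ _ cons_measure
  cons_measure_sigma_finite.

End cons_measure.

Fixpoint power_measure (n : nat) :
    {sigma_finite_measure set (n.-tuple T) -> \bar R} :=
  match n with
  | 0 => \d_([tuple] : 0.-tuple T)
  | n'.+1 => cons_measure (power_measure n')
  end.

End power_measure.


Section compound_random_measure.
Local Open Scope ereal_scope.
Context (R : realType).
Let mR := measurableTypeR R.

Definition lebesgue_tuple (d : nat) := power_measure (@lebesgue_measure R) d.

(* A measure on (0, oo) is represented by a measure on R of which only the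
   restriction to `positives` is ever used; similarly for (0, oo)^d and for
   products with another space. *)
Definition positives : set mR := `]0%R, +oo[%classic.

Definition positive_tuples (d : nat) : set (d.-tuple mR) :=
  [set s | forall i, positives (tnth s i)].

(* nu (da, db) = m1 (da) m2 (db) on D x T2. *)
Definition product_form {d1 d2} {T1 : measurableType d1}
    {T2 : measurableType d2} (D : set T1) (nu : set (T1 * T2) -> \bar R)
    (m1 : set T1 -> \bar R) (m2 : set T2 -> \bar R) :=
  forall A B, measurable A -> A `<=` D -> measurable B ->
    nu (A `*` B) = m1 A * m2 B.

Definition levy_intensity (X : polishType R)
    (nu : {measure set (mR * borel X) -> \bar R}) :=
  forall Y : set (borel X), measurable Y -> mbounded (Y : set X) ->
    \int[nu]_(p in positives `*` Y) (Num.min 1 (p.1 : R))%:E < +oo.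

Section corm.
Variables (d : nat) (h : d.-tuple mR -> R).

Definition scaled_score (z : R) (s : d.-tuple mR) : R :=
  (z ^- d * h [tuple (tnth s i / z)%R | i < d])%R.

(* The measure int_z z^-d h(s_1/z, ..., s_d/z) ds nu*(dz, dx). *)
Definition corm_intensity {dX} {X : measurableType dX}
    (nustar : {measure set (mR * X) -> \bar R})
    (A : set (d.-tuple mR * X)) : \bar R :=
  \int[nustar]_(p in positives `*` setT)
    \int[lebesgue_tuple d]_(s in [set s | positive_tuples s /\ A (s, p.2)])
      (scaled_score p.1 s)%:E.

Definition corm_density (rho : {measure set mR -> \bar R})
    (s : d.-tuple mR) : \bar R :=
  \int[rho]_(z in positives) (scaled_score z s)%:E.

End corm.

Definition marginal {dX} {X : measurableType dX} (d : nat) (j : 'I_d)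
    (nu : set (d.-tuple mR * X) -> \bar R) : set (mR * X) -> \bar R :=
  pushforward nu (fun p => (tnth p.1 j, p.2)).

Definition exponential_score (d : nat) (s : d.-tuple mR) : R :=
  (\prod_(i < d) expR (- tnth s i))%R.

Definition exponential_marginal (rho : {measure set mR -> \bar R}) (s : R) :
    \bar R :=
  \int[rho]_(z in positives) (z^-1 * expR (- s / z))%:E.

End compound_random_measure.

(* Main.v *)
(* Independent exponential scores turn the integrand of the joint density into
   z^-d e^(-(s_1 + ... + s_d)/z), a function of the sum of the coordinates, and
   each differentiation of z^-1 e^(-s/z) in s brings down a factor -z^-1. So the
   joint density is f differentiated d - 1 times under the integral sign. The
   integrals converge because z^-n e^(-s/z) <= C min(1, z), and min(1, z) is
   rho-integrable: the Levy condition holds on a bounded set charged by alpha.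
   The same condition makes rho sigma-finite on (0, oo), as Tonelli requires. *)
Require Import Defs.
From HB Require Import structures.
From mathcomp Require Import all_boot all_order all_algebra.
From mathcomp Require Import all_classical all_reals all_analysis.
From mathcomp Require Import measurable_realfun ring.
Set Implicit Arguments.
Unset Strict Implicit.
Unset Printing Implicit Defensive.
Import Order.TTheory GRing.Theory Num.Theory.
Import numFieldNormedType.Exports.
Local Open Scope classical_set_scope.
Local Open Scope ring_scope.

(** * Integration against power measures, product-form measures and restrictions *)

Section integration.
Local Open Scope ereal_scope.
Context {R : realType}.

Lemma measurable_prod_tnth {d} {T : measurableType d} (n : nat)
    (g : 'I_n -> T -> R) : (forall i, measurable_fun setT (g i)) ->
  measurable_fun setT (fun v : n.-tuple T => (\prod_(i < n) g i (tnth v i))%R).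
Proof.
move=> mg; apply: measurable_prod => i _.
by apply: measurableT_comp => //; exact: measurable_tnth.
Qed.

(** By induction on [n]: the power measure of order [n.+1] is the image under cons of [mu] times the
    power measure of order [n], so Tonelli splits off the head factor. *)
Lemma integral_power_measure_prod {d} {T : measurableType d}
    (mu : {sigma_finite_measure set T -> \bar R}) (n : nat)
    (g : 'I_n -> T -> R) :
  (forall i, measurable_fun setT (g i)) -> (forall i x, (0 <= g i x)%R) ->
  \int[power_measure mu n]_v (\prod_(i < n) g i (tnth v i))%:E =
  \prod_(i < n) \int[mu]_x (g i x)%:E.
Proof.
have F0 m (f : 'I_m -> T -> R) : (forall i x, (0 <= f i x)%R) ->
    forall v : m.-tuple T, 0 <= (\prod_(i < m) f i (tnth v i))%:E.
  by move=> f0 v; rewrite lee_fin prodr_ge0.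
have mF m (f : 'I_m -> T -> R) : (forall i, measurable_fun setT (f i)) ->
    measurable_fun [set: m.-tuple T]
      (fun v => (\prod_(i < m) f i (tnth v i))%:E : \bar R).
  by move=> mf; apply/measurable_EFinP; exact: measurable_prod_tnth.
elim: n g => [|n IH] g mg g0.
  rewrite integral_dirac//; last exact: mF.
  by rewrite !big_ord0 diracT mul1e.
have mcons : measurable_fun [set: T * n.-tuple T]
    (fun p => [tuple of p.1 :: p.2] : n.+1.-tuple T).
  exact: measurable_cons.
rewrite /= /cons_measure ge0_integral_pushforward//; last 2 first.
- exact: mF.
- by move=> v _; exact: F0.
rewrite preimage_setT fubini_tonelli1; last 2 first.
- exact: measurableT_comp (mF _ _ mg) mcons.
- by move=> p; exact: F0.
pose C := \prod_(i < n) \int[mu]_x (g (lift ord0 i) x)%:E.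
have C0 : 0 <= C.
  by apply: prode_ge0 => i _; apply: integral_ge0 => x _; rewrite lee_fin.
rewrite big_ord_recl -/C muleC -ge0_integralZl//; last 2 first.
- exact/measurable_EFinP.
- by move=> x _; rewrite lee_fin.
apply: eq_integral => x _; rewrite /fubini_F /= /C muleC -IH// -ge0_integralZl//.
- apply: eq_integral => v _; rewrite big_ord_recl EFinM.
  by under eq_bigr do rewrite tnthS.
- exact: (mF _ (fun i => g (lift ord0 i))).
- by move=> v _; exact: (F0 _ (fun i => g (lift ord0 i))).
- by rewrite lee_fin.
Qed.

Lemma nneseries_cst (x : \bar R) : 0 <= x -> \sum_(n <oo) x = x * +oo.
Proof.
move=> x0; rewrite -(ge0_integral_count (a := fun=> x))// integral_cst//.
by rewrite /= /counting asboolF//; exact: infinite_nat.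
Qed.

(** An infinite [c] has to be allowed: it will be the measure of an arbitrary set [B] of the second
    factor. *)
Lemma ge0_integral_measure_mule {d} {T : measurableType d} (D : set T)
    (m mu : {measure set T -> \bar R}) (c : \bar R) (g : T -> \bar R) :
  measurable D -> measurable_fun D g -> (forall x, D x -> 0 <= g x) ->
  0 <= c -> (forall A, measurable A -> A `<=` D -> m A = mu A * c) ->
  \int[m]_(x in D) g x = (\int[mu]_(x in D) g x) * c.
Proof.
move=> mD mg g0; case: c => [c| |]// c0 mE.
  rewrite (eq_measure_integral (mscale (NngNum c0) mu)); last first.
    by move=> A mA AD; rewrite mE// /mscale/= muleC.
  by rewrite ge0_integral_mscale// muleC.
(* For c = +oo, m is the sum of countably many copies of mu. *)
rewrite (eq_measure_integral (mseries (fun=> mu) 0)); last first.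
  by move=> A mA AD; rewrite mE//= /mseries nneseries_cst.
by rewrite ge0_integral_measure_series// nneseries_cst// integral_ge0.
Qed.

Lemma ge0_integral_mrestr {d} {T : measurableType d} (D E : set T)
    (mE : measurable E) (mu : {measure set T -> \bar R}) (g : T -> \bar R) :
  measurable D -> measurable_fun D g -> (forall x, D x -> 0 <= g x) ->
  \int[mrestr mu mE]_(x in D) g x = \int[mu]_(x in D `&` E) g x.
Proof.
move=> mD mg g0.
rewrite (@ge0_negligible_integral _ _ _ _ D (~` E))//; last 2 first.
- exact: measurableC.
- by rewrite /= /mrestr setICl measure0.
rewrite setDE setCK; apply: eq_measure_integral => A mA AD.
by rewrite /= /mrestr setIidl//; apply: subset_trans AD _; exact: subIsetr.
Qed.

(** With [B] fixed, sending [A] to [nu (A]*[B)] is a measure in [A], the image of a restriction of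
    [nu] under the first projection. On subsets of [D] it is [m1] scaled by [m2 B], and change of
    variables concludes. *)
Lemma integral_product_form {d1 d2} {T1 : measurableType d1}
    {T2 : measurableType d2} (D : set T1) (nu : {measure set (T1 * T2) -> \bar R})
    (m1 : {measure set T1 -> \bar R}) (m2 : {measure set T2 -> \bar R})
    (B : set T2) (g : T1 -> \bar R) :
  measurable D -> product_form D nu m1 m2 -> measurable B ->
  measurable_fun D g -> (forall x, D x -> 0 <= g x) ->
  \int[nu]_(p in D `*` B) g p.1 = (\int[m1]_(x in D) g x) * m2 B.
Proof.
move=> mD nuE mB mg g0.
have mTB : measurable ([set: T1] `*` B) by exact: measurableX.
have mf : measurable_fun [set: T1 * T2] fst by exact: measurable_fst.
rewrite -(@ge0_integral_measure_mule _ _ D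
    (pushforward (mrestr nu mTB) fst) m1 (m2 B))//; last first.
  move=> A mA AD; rewrite /pushforward/= /mrestr -nuE//; congr (nu _).
  by apply/seteqP; split=> [p [] ? []|p []].
rewrite [RHS]ge0_integral_pushforward//; last by move=> x /set_mem; exact: g0.
rewrite ge0_integral_mrestr.
- by congr integral; apply/seteqP; split=> [p []|p [] ? []].
- by rewrite -[X in measurable X]setTI; exact: mf.
- by apply: (measurable_comp mD) => //; [move=> _ [p Dp <-]|exact: measurable_funTS].
- by move=> p; exact: g0.
Qed.

(** Restricting [mu] to [D] and extending [f] by zero off the rectangle reduces the claim to Tonelli
    on the whole product. *)
Lemma tonelli_sigma_finite {d1 d2} {T1 : measurableType d1}
    {T2 : measurableType d2} (D : set T1) (E : set T2)
    (mu : {measure set T1 -> \bar R})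
    (m2 : {sigma_finite_measure set T2 -> \bar R}) (f : T1 * T2 -> \bar R) :
  measurable D -> measurable E -> sigma_finite D mu ->
  measurable_fun (D `*` E) f -> (forall p, (D `*` E) p -> 0 <= f p) ->
  \int[mu]_(x in D) \int[m2]_(y in E) f (x, y) =
  \int[m2]_(y in E) \int[mu]_(x in D) f (x, y).
Proof.
move=> mD mE [F DF Foo] mf f0.
have sf : sigma_finite setT (mrestr mu mD).
  (* The complement of [D], null for the restricted measure, becomes piece 0 of the cover and shifts
     the given pieces by one. *)
  exists (fun n => if n is n'.+1 then F n' else ~` D).
    apply/seteqP; split=> // x _; have [Dx|nDx] := pselect (D x).
      by move: Dx; rewrite DF => -[n _ Fx]; exists n.+1.
    by exists 0%N.
  move=> [|n]; first by split; [exact: measurableC|rewrite /mrestr setICl measure0].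
  have [mF Fn] := Foo n; split => //; apply: le_lt_trans Fn.
  by rewrite /mrestr le_measure ?inE//; exact: measurableI.
pose m1 : {sigma_finite_measure set T1 -> \bar R} :=
  HB.pack (mrestr mu mD) (Measure_isSigmaFinite.Build _ _ _ (mrestr mu mD) sf).
pose g := f \_ (D `*` E).
have mDE : measurable (D `*` E) by exact: measurableX.
have mg : measurable_fun setT g by exact: (measurable_restrictT _ mDE).1 mf.
have g0 p : 0 <= g p by exact: erestrict_ge0.

have toD h : measurable_fun setT h -> (forall x, 0 <= h x) ->
    (forall x, ~ D x -> h x = 0) -> \int[m1]_x h x = \int[mu]_(x in D) h x.
  move=> mh h0 hD; rewrite [LHS]ge0_integral_mrestr ?setTI//.
have gE x y : x \in D -> y \in E -> g (x, y) = f (x, y).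
  by move=> Dx Ey; rewrite /g patchE in_setX Dx Ey.
have g0D x y : x \notin D -> g (x, y) = 0.
  by move=> Dx; rewrite /g patchE in_setX (negbTE Dx).
have g0E x y : y \notin E -> g (x, y) = 0.
  by move=> Ey; rewrite /g patchE in_setX (negbTE Ey) andbF.
transitivity (\int[m1]_x \int[m2]_y g (x, y)).
  rewrite toD.
  - apply: eq_integral => x Dx; rewrite integral_mkcond.
    apply: eq_integral => y _; rewrite patchE.
    by case: ifPn => Ey; [rewrite gE|rewrite g0E].
  - exact: (measurable_fun_fubini_tonelli_F (m2 := m2) g mg g0).
  - by move=> x; exact: integral_ge0.
  - by move=> x Dx; apply: integral0_eq => y _; apply: g0D; rewrite notin_setE.
rewrite fubini_tonelli// [RHS]integral_mkcond.
apply: eq_integral => y _; rewrite patchE; case: ifPn => Ey.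
  rewrite toD//.
  - by apply: eq_integral => x Dx; rewrite gE.
  - exact: measurable_fun_pair1 mg.
  - by move=> x Dx; apply: g0D; rewrite notin_setE.
by apply: integral0_eq => x _; exact: g0E.
Qed.

(** On [D] the function agrees with the section integral of the zero extension of [f], whose
    measurability is part of Tonelli's theorem. *)
Lemma measurable_fun_integral_section {d1 d2} {T1 : measurableType d1}
    {T2 : measurableType d2} (D : set T1) (E : set T2)
    (m2 : {sigma_finite_measure set T2 -> \bar R}) (f : T1 * T2 -> \bar R) :
  measurable D -> measurable E ->
  measurable_fun (D `*` E) f -> (forall p, (D `*` E) p -> 0 <= f p) ->
  measurable_fun D (fun x => \int[m2]_(y in E) f (x, y)).
Proof.
move=> mD mE mf f0; pose g := f \_ (D `*` E).
have mDE : measurable (D `*` E) by exact: measurableX.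
have mg : measurable_fun setT g by exact: (measurable_restrictT _ mDE).1 mf.
have g0 p : 0 <= g p by exact: erestrict_ge0.
apply: (@eq_measurable_fun _ _ _ _ _ (fubini_F m2 g)).
  move=> x Dx; rewrite /fubini_F [RHS]integral_mkcond; apply: eq_integral => y _.
  by rewrite /g !patchE in_setX Dx.
by apply: measurable_funTS; exact: measurable_fun_fubini_tonelli_F.
Qed.

End integration.

(** * Measurability and domination of the kernel z^-n e^(-s/z) *)

Section exponential_kernel.
Context {R : realType}.
Local Notation mR := (measurableTypeR R).

Lemma measurable_positives : measurable (@positives R).
Proof. exact: measurable_itv. Qed.

Lemma measurable_funV {d} {T : measurableType d} (D : set T) (f : T -> mR) :
  measurable D -> measurable_fun D f -> measurable_fun D (fun x => (f x)^-1 : mR).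
Proof.
move=> mD mf.
suff mV : measurable_fun setT (fun z : mR => z^-1 : mR) by exact: measurableT_comp mV mf.
(* Inversion is continuous off 0, and on the singleton at 0 any function is measurable. *)
rewrite -(setUv [set 0%R]); apply/measurable_funU => //.
  exact: measurableC.
split; first exact: measurable_fun_set1.
apply: open_continuous_measurable_fun.
  rewrite (_ : ~` _ = [set x : R | x != 0]); first exact: open_neq.
  by apply/seteqP; split=> x /= /eqP.
by move=> z /set_mem /= /eqP z0; exact: inv_continuous.
Qed.

Lemma positives_gt0 (z : mR) : positives z -> 0 < (z : R).
Proof. by rewrite /positives/= in_itv/= andbT. Qed.

Lemma measurable_power_expR {d} {T : measurableType d} (n : nat) (f g : T -> mR) :
  measurable_fun setT f -> measurable_fun setT g ->
  measurable_fun setT (fun t => ((f t)^-1 ^+ n * expR (- g t / f t)) : R).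
Proof.
move=> mf mg; have mV := measurable_funV measurableT mf.
apply: measurable_funM; first exact: measurable_funX.
apply: measurableT_comp => //; apply: measurable_funM => //.
exact: measurableT_comp.
Qed.

(** For z >= 1 both factors are at most 1. For z < 1, the Taylor bound e^u >= u^(n+1)/(n+1)! at u =
    s/z is used with exponent n+1 rather than n, which leaves one spare factor z. *)
Lemma power_expR_le (n : nat) (s z : R) : 0 < s -> 0 < z ->
  z^-1 ^+ n * expR (- s / z) <= (1 + (n.+1)`!%:R / s ^+ n.+1) * Num.min 1 z.
Proof.
move=> s0 z0; have sz0 : 0 < s / z by rewrite divr_gt0.
have V0 : 0 < z^-1 by rewrite invr_gt0.
have C0 : 0 <= (n.+1)`!%:R / s ^+ n.+1 by rewrite divr_ge0// exprn_ge0// ltW.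
have [z1|z1] := leP 1 z.
  rewrite mulr1 (@le_trans _ _ 1)//; last by rewrite lerDl.
  apply: mulr_ile1; rewrite ?expR_ge0//; first by rewrite exprn_ge0// ltW.
    by rewrite exprn_ile1 ?invf_le1// ltW.
  by rewrite -expR0 ler_expR mulNr oppr_le0 ltW.
apply: (@le_trans _ _ ((n.+1)`!%:R / s ^+ n.+1 * z)); last first.
  by rewrite ler_wpM2r ?ltW// ltrDr.
rewrite mulNr expRN.
have := expR_ge1Dxn n (ltW sz0).
have E0 := expR_gt0 (s / z).
have W0 : 0 < (n.+1)`!%:R :> R by rewrite ltr0n fact_gt0.
move=> H; have {}H : (s / z) ^+ n.+1 / (n.+1)`!%:R <= expR (s / z).
  by apply: le_trans H; rewrite lerDr.
rewrite ler_pdivrMr//.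
apply: le_trans (ler_wpM2l _ H); last by rewrite mulr_ge0// ltW.
(* After the Taylor bound the two sides are equal: the factorials and powers of s cancel. *)
rewrite le_eqVlt; apply/orP; left; apply/eqP.
rewrite exprMn !exprVn !exprS; field.
by rewrite !expf_neq0 ?pnatr_eq0 -?lt0n ?fact_gt0 ?gt_eqF.
Qed.

End exponential_kernel.

(** * Consequences of the Lévy condition for [rho] *)

Section levy.
Context {R : realType} {X : polishType R}.
Variables (rho : {measure set (measurableTypeR R) -> \bar R})
  (alpha : {measure set (borel X) -> \bar R})
  (nu : {measure set (measurableTypeR R * borel X) -> \bar R}).

Lemma measurable_ball_borel (x : X) (r : R) : measurable (ball x r : set (borel X)).
Proof.
apply: sub_sigma_algebra; rewrite /= openE ballEmdist => y /= xy.
have ryx : 0 < r - mdist x y by rewrite subr_gt0.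
apply: filterS (nbhsx_ballx y _ ryx) => z; rewrite ballEmdist /= => yz.
by rewrite (le_lt_trans (metric_triangle _ y _))// addrC -ltrBrDr.
Qed.

(** Balls of integer radius around one point cover the space; if all were null, countable
    subadditivity would make [alpha] zero. *)
Lemma bounded_positive_measure : alpha setT != 0%E ->
  exists Y : set (borel X), [/\ measurable Y, mbounded (Y : set X) & alpha Y != 0%E].
Proof.
move=> aT.
have [x0 _] : [set: X] !=set0.
  by apply/set0P; apply: contra aT => /eqP X0; rewrite X0 measure0.
pose B n : set (borel X) := ball x0 n%:R.
have BT : \bigcup_n B n = setT.
  apply/seteqP; split => // y _.
  exists (Num.truncn (mdist x0 y)).+1 => //.
  by rewrite /B ballEmdist /= truncnS_gt.
have [n Bn] : exists n, alpha (B n) != 0%E.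
  apply: contrapT => /forallNP B0; move/negP: aT; apply; rewrite -measure_le0 -BT.
  have mB n : measurable (B n) by exact: measurable_ball_borel.
  have mBT : measurable (\bigcup_n B n) by exact: bigcup_measurable.
  have := measure_sigma_subadditive alpha mB mBT (@subset_refl _ _).
  move=> /le_trans; apply; rewrite eseries0// => n _ _.
  by apply/eqP; apply: contraT => /B0.
exists (B n); split => //; first exact: measurable_ball_borel.
exists (n%:R + n%:R) => x y; rewrite /B ballEmdist /= => x0x x0y.
by rewrite (le_trans (metric_triangle _ x0 _))// lerD ?ltW// metric_sym.
Qed.

Hypothesis nu_levy : levy_intensity nu.
Hypothesis nu_prod : product_form (@positives R) nu rho alpha.
Hypothesis alpha_neq0 : alpha setT != 0%E.

Let measurable_min1 :
  measurable_fun setT (fun z : measurableTypeR R => (Num.min 1 (z : R))%:E).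
Proof. by apply/measurable_EFinP; exact: measurable_minr. Qed.

(** Over a bounded [Y] with [alpha Y] nonzero, the Lévy integral factors as this integral times
    [alpha Y]. An infinite first factor would make the product infinite. *)
Lemma levy_integral_lty :
  (\int[rho]_(z in @positives R) (Num.min 1 (z : R))%:E < +oo)%E.
Proof.
have [Y [mY bY Y0]] := bounded_positive_measure alpha_neq0.
have := nu_levy mY bY.
rewrite (integral_product_form (g := fun z : measurableTypeR R =>
  (Num.min 1 (z : R))%:E) _ nu_prod)//.
- rewrite !ltey; apply: contra => /eqP ->; rewrite gt0_mulye//.
  by rewrite lt0e Y0/=.
- exact: measurable_positives.
- exact: measurable_funTS.
- by move=> z /positives_gt0 z0; rewrite lee_fin le_min ler01 ltW.
Qed.

(** Markov's inequality: min(1, z) >= 1/(n+1) on [1/(n+1), oo), so [rho] is finite on each of these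
    sets, and they exhaust (0, oo). *)
Lemma levy_sigma_finite : sigma_finite (@positives R) rho.
Proof.
pose F n : set (measurableTypeR R) := `[n.+1%:R^-1, +oo[%classic.
have mF n : measurable (F n) by exact: measurable_itv.
have FD n : F n `<=` @positives R.
  move=> z; rewrite /F /positives/= !in_itv/= !andbT; apply: lt_le_trans.
  by rewrite invr_gt0.
have m0 z : @positives R z -> (0 <= (Num.min 1 (z : R))%:E)%E.
  by move=> /positives_gt0 z0; rewrite lee_fin le_min ler01 ltW.
exists F; first (apply/seteqP; split).
- move=> z /positives_gt0 z0.
  exists (Num.truncn (z : R)^-1) => //=.
  by rewrite /F/= in_itv/= andbT invf_ple ?posrE// ltW// truncnS_gt.
- by move=> z [n _]; exact: FD.
- move=> n; split => //.
  have : ((n.+1%:R^-1)%:E * rho (F n) < +oo)%E.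
    rewrite -integral_cst//; apply: le_lt_trans levy_integral_lty.
    apply: (@le_trans _ _ (\int[rho]_(z in F n) (Num.min 1 (z : R))%:E)%E).
      apply: ge0_le_integral => //.
      - by move=> z _; rewrite lee_fin.
      - exact: measurable_funTS.
      - move=> z; rewrite /F/= in_itv/= andbT => nz.
        by rewrite lee_fin le_min nz invf_le1// ler1n.
    apply: ge0_subset_integral => //.
    - exact: measurable_positives.
    - exact: measurable_funTS.
  rewrite !ltey; apply: contra => /eqP ->.
  by rewrite gt0_muley// lte_fin invr_gt0.
Qed.

Lemma integrable_power_expR (n : nat) (s : R) : 0 < s ->
  rho.-integrable (@positives R) (fun z => ((z : R)^-1 ^+ n * expR (- s / z))%:E).
Proof.
move=> s0; pose C := 1 + (n.+1)`!%:R / s ^+ n.+1.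
have mD := @measurable_positives R.
apply: (@le_integrable _ _ _ _ _ mD _ (fun z => C%:E * (Num.min 1 (z : R))%:E)%E).
- by apply: measurable_funTS; apply/measurable_EFinP; exact: (measurable_power_expR n).
- move=> z /positives_gt0 z0; rewrite lee_fin ger0_norm; last first.
    by rewrite mulr_ge0 ?expR_ge0// exprn_ge0// invr_ge0 ltW.
  by apply: le_trans (ler_norm _); exact: power_expR_le.
- apply: integrableZl => //; apply/integrableP; split; first exact: measurable_funTS.
  rewrite (eq_integral (fun z : measurableTypeR R => (Num.min 1 (z : R))%:E)).
    exact: levy_integral_lty.
  move=> z /set_mem/positives_gt0 z0.
  by rewrite gee0_abs// lee_fin le_min ler01 ltW.
Qed.

End levy.

(** * Repeated differentiation under the integral sign *)

Section derivatives.
Context {R : realType}.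
Local Notation mR := (measurableTypeR R).

(** Valid for every [z]: only [z^-1] enters, and the convention 0^-1 = 0 makes the function constant
    at z = 0. *)
Lemma is_derive_power_expR (n : nat) (z s : R) :
  is_derive s 1 (fun x : R => z^-1 ^+ n * expR (- x / z))
    (- (z^-1 ^+ n.+1 * expR (- s / z))).
Proof.
have H : is_derive s 1 (fun x : R => - x / z) (- z^-1).
  rewrite (_ : (fun x => _) = (fun x => - z^-1 * x)); last first.
    by apply/funext => x; rewrite mulNr mulrC mulNr.
  by apply: is_derive_eq; exact: mulr1.
by apply: is_derive_eq; rewrite exprS /GRing.scale/=; ring.
Qed.

Variables (rho : {measure set mR -> \bar R}).
Hypothesis rho_int : forall (n : nat) (s : R), 0 < s ->
  rho.-integrable (@positives R) (fun z => ((z : R)^-1 ^+ n * expR (- s / z))%:E).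

Let F (n : nat) (s : R) : R :=
  (\int[rho]_(z in @positives R) ((z : R)^-1 ^+ n * expR (- s / z)))%R.

(** The window ]s/2, s+1[ keeps x away from 0. There e^(-x/z) <= e^(-(s/2)/z), so the kernel of
    order [n.+1] at s/2 dominates all the partial derivatives and is integrable. *)
Lemma is_derive_Rintegral_power_expR (n : nat) (s : R) : 0 < s ->
  is_derive s 1 (F n) (- F n.+1 s).
Proof.
move=> s0.
pose f (x : R) (z : mR) : R := (z : R)^-1 ^+ n * expR (- x / z).
(* The norm makes the dominating function nonnegative off (0, oo) too. *)
pose G (z : mR) : R := `|(z : R)^-1 ^+ n.+1 * expR (- (s / 2) / z)|.
have s20 : 0 < s / 2 by rewrite divr_gt0.
have mD := @measurable_positives R.
have Is : `]s / 2, (s + 1)[%classic s.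
  by rewrite /= in_itv/= ltrDl ltr01 andbT ltr_pdivrMr// ltr_pMr// ltr1n.
have If x : `]s / 2, (s + 1)[%classic x ->
    rho.-integrable (@positives R) (EFin \o f x).
  rewrite /= in_itv/= => /andP[sx _]; apply: rho_int.
  exact: lt_trans sx.
have df x (z : mR) : `]s / 2, (s + 1)[%classic x -> positives z ->
    derivable (f ^~ z) x 1.
  by move=> _ _; have [] := is_derive_power_expR n z x.
have dfE x (z : mR) : partial1of2 f x z = - ((z : R)^-1 ^+ n.+1 * expR (- x / z)).
  by rewrite partial1of2E; have [_ ->] := is_derive_power_expR n z x.
have IG : rho.-integrable (@positives R) (EFin \o G).
  by apply: integrable_norm; exact: rho_int.
have GE x (z : mR) : `]s / 2, (s + 1)[%classic x -> positives z ->
    `|partial1of2 f x z| <= G z.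
  rewrite /= in_itv/= => /andP[sx _] /positives_gt0 z0.
  rewrite dfE normrN /G !normrM; apply: ler_wpM2l; first exact: normr_ge0.
  rewrite !ger0_norm ?expR_ge0//.
  by rewrite ler_expR ler_pM2r ?invr_gt0// lerN2 ltW.
have G0 z : 0 <= G z by exact: normr_ge0.
split.
  exact: (derivable_under_integral mD Is If df G0 IG GE).
rewrite -derive1E.
rewrite (differentiation_under_integral mD Is If df G0 IG GE).
rewrite -mulN1r -RintegralZl//; last exact: rho_int.
by apply: eq_Rintegral => z _; rewrite dfE mulN1r.
Qed.

Let is_derive_signed (k m : nat) (s : R) : 0 < s ->
  is_derive s 1 (fun x => (-1) ^+ k * F m x) ((-1) ^+ k.+1 * F m.+1 s).
Proof.
move=> s0; have D := is_derive_Rintegral_power_expR m s0.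
by apply: is_derive_eq; rewrite exprS mulN1r mulNr; exact: mulrN.
Qed.

Lemma derive1n_Rintegral_power_expR (m k : nat) (s : R) : 0 < s ->
  derive1n k (F m) s = (-1) ^+ k * F (m + k) s.
Proof.
elim: k s => [|k IH] s s0; first by rewrite derive1n0 expr0 mul1r addn0.
rewrite derive1nS derive1E.
(* The induction hypothesis holds only at positive points, but these form a neighbourhood of [s] and
   differentiation is local. *)
rewrite (@near_eq_derive _ _ _ _ (fun x => (-1) ^+ k * F (m + k) x)); last first.
  near=> x; apply: IH; near: x; exact: lt_nbhsr.
by have [_ ->] := is_derive_signed k (m + k) s0; rewrite addnS.
Unshelve. all: by end_near. Qed.

Lemma derivable_Rintegral_power_expR (m k : nat) (s : R) : 0 < s ->
  derivable (derive1n k (F m)) s 1.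
Proof.
move=> s0.
apply: (@near_eq_derivable _ _ _ (fun x => (-1) ^+ k * F (m + k) x)).
  near=> x; symmetry; apply: derive1n_Rintegral_power_expR; near: x; exact: lt_nbhsr.
by have [] := is_derive_signed k (m + k) s0.
Unshelve. all: by end_near. Qed.

End derivatives.

(** * The compound intensity on rectangles, for a general score *)

Section corm_rectangles.
Local Open Scope ereal_scope.

Context {R : realType}.
Local Notation mR := (measurableTypeR R).

Lemma measurable_positive_tuples (d : nat) : measurable (@positive_tuples R d).
Proof.
rewrite (_ : @positive_tuples R d =
    \bigcap_(i in [set: 'I_d]) ((@tnth d mR)^~ i @^-1` @positives R)).
  apply: fin_bigcap_measurable => // i _; rewrite -[X in measurable X]setTI.
  exact: (measurable_tnth i measurableT measurable_positives).
by apply/seteqP; split=> [s sD i _|s sD i]; [exact: sD|exact: sD i I].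
Qed.

Variables (d : nat) (h : d.-tuple mR -> R).
Hypotheses (mh : measurable_fun setT h) (h0 : forall s, (0 <= h s)%R).

Lemma measurable_scaled_score :
  measurable_fun setT (fun p : mR * d.-tuple mR => (scaled_score h p.1 p.2)%:E).
Proof.
have mf : measurable_fun [set: mR * d.-tuple mR] fst by exact: measurable_fst.
have mV := measurable_funV measurableT mf.
apply/measurable_EFinP; rewrite /scaled_score; apply: measurable_funM.
  rewrite (_ : (fun _ => _) = (fun p : mR * d.-tuple mR => (p.1 : R)^-1 ^+ d)%R).
    exact: measurable_funX.
  by apply/funext => p; rewrite exprVn.
apply: measurableT_comp => //; apply/measurable_fun_tnthP => i.
rewrite (_ : _ \o _ =
    (fun p : mR * d.-tuple mR => ((tnth p.2 i : R) / (p.1 : R))%R : mR)).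
  apply: measurable_funM => //.
  exact: measurableT_comp (measurable_tnth i) measurable_snd.
by apply/funext => p /=; rewrite tnth_mktuple.
Qed.

Lemma scaled_score_ge0 (z : mR) (s : d.-tuple mR) :
  positives z -> 0 <= (scaled_score h z s)%:E.
Proof.
move=> /positives_gt0 z0.
by rewrite lee_fin mulr_ge0// invr_ge0 exprn_ge0// ltW.
Qed.

Lemma corm_intensity_setX {dX} {X : measurableType dX}
    (rho : {measure set mR -> \bar R}) (alpha : {measure set X -> \bar R})
    (nu : {measure set (mR * X) -> \bar R}) (S : set (d.-tuple mR)) (B : set X) :
  product_form (@positives R) nu rho alpha -> measurable S -> measurable B ->
  corm_intensity h nu (S `*` B) =
  (\int[rho]_(z in @positives R)
    \int[lebesgue_tuple R d]_(s in @positive_tuples R d `&` S)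
      (scaled_score h z s)%:E) * alpha B.
Proof.
move=> nuE mS mB; rewrite /corm_intensity.
have mD := @measurable_positives R.
have mPS : measurable (@positive_tuples R d `&` S).
  by apply: measurableI => //; exact: measurable_positive_tuples.
rewrite -(integral_product_form mD nuE mB); last 2 first.
- apply: (measurable_fun_integral_section (lebesgue_tuple R d)
    (f := fun p => (scaled_score h p.1 p.2)%:E)) => //.
    exact: measurable_funTS measurable_scaled_score.
  by move=> p [Dp _]; exact: scaled_score_ge0.
- by move=> z Dz; apply: integral_ge0 => s _; exact: scaled_score_ge0.
(* With both outer integrals extended by zero, the integrands agree pointwise: the condition that
   (s, x) lies in the rectangle reduces to s in [S] when x is in [B], and empties the inner domain
   otherwise. *)
rewrite integral_mkcond [RHS]integral_mkcond; apply: eq_integral => -[z x] _.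
rewrite !patchE !in_setX in_setT andbT /=; case: (z \in _) => //=.
case: ifPn => [/set_mem Bx|].
  by congr integral; apply/seteqP; split=> s [sD]; [case|].

rewrite notin_setE => nBx; rewrite (_ : [set s | _] = set0) ?integral_set0//.
by apply/seteqP; split=> // s [_ []].
Qed.

End corm_rectangles.

(** * The exponential score and its marginals *)

Section exponential_score.
Local Open Scope ereal_scope.
Context {R : realType}.
Local Notation mR := (measurableTypeR R).

Lemma measurable_exponential_score (d : nat) :
  measurable_fun setT (@exponential_score R d).
Proof.
apply: (@measurable_prod_tnth _ _ _ _ (fun _ (x : mR) => expR (- (x : R)))) => i.
exact: measurableT_comp.
Qed.

Lemma exponential_score_ge0 (d : nat) (s : d.-tuple mR) :
  (0 <= exponential_score s)%R.
Proof. by apply: prodr_ge0 => i _; exact: expR_ge0. Qed.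

(** Spreading z^-d as one z^-1 per coordinate gives the factorized form that lets the coordinates be
    integrated out separately. *)
Lemma scaled_exponential_score (d : nat) (z : mR) (s : d.-tuple mR) :
  scaled_score (@exponential_score R d) z s =
  (\prod_(i < d) ((z : R)^-1 * expR (- (tnth s i : R) / z)))%R.
Proof.
rewrite /scaled_score /exponential_score big_split/= prodr_const card_ord exprVn.
by congr (_ * _)%R; apply: eq_bigr => i _; rewrite tnth_mktuple mulNr.
Qed.

Lemma scaled_exponential_score_sum (d : nat) (z : mR) (s : d.-tuple mR) :
  scaled_score (@exponential_score R d) z s =
  ((z : R)^-1 ^+ d * expR (- (\sum_(i < d) (tnth s i : R)) / z))%R.
Proof.
rewrite scaled_exponential_score big_split/= prodr_const card_ord.
by rewrite -expR_sum -big_distrl/= sumrN.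
Qed.

(** The integrand is the exponential density of rate [z^-1]; including the endpoint 0 does not
    change the integral. *)
Lemma integral_exponential_kernel (z : R) : (0 < z)%R ->
  \int[lebesgue_measure]_(x in @positives R) (z^-1 * expR (- (x : R) / z))%:E = 1.
Proof.
move=> z0; have V0 : (0 < z^-1)%R by rewrite invr_gt0.
rewrite /positives integral_itv_obnd_cbnd.
  rewrite -(integral_exponential_pdf V0) integral_mkcond.
  apply: eq_integral => x _; rewrite /exponential_pdf !patchE.
  case: ifP => // _.
  by rewrite mulNr [(x / z)%R]mulrC mulNr.
apply: measurable_funTS; apply/measurable_EFinP.
exact: (measurable_power_expR 1 (f := fun=> z)).
Qed.

(** Score and domain both factor over the coordinates, so the integral is a product of
    one-dimensional ones, of which all but the [j]-th equal 1. *)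
Lemma integral_exponential_score_coordinate (d : nat) (j : 'I_d) (A : set mR)
    (z : mR) :
  measurable A -> A `<=` @positives R -> positives z ->
  \int[lebesgue_tuple R d]_(s in @positive_tuples R d `&` ((@tnth d mR)^~ j @^-1` A))
    (scaled_score (@exponential_score R d) z s)%:E =
  \int[lebesgue_measure]_(x in A) ((z : R)^-1 * expR (- (x : R) / z))%:E.
Proof.
move=> mA AD /positives_gt0 z0.
pose E i : set mR := if i == j then A else @positives R.
pose k (x : mR) : R := ((z : R)^-1 * expR (- (x : R) / z))%R.
have k0 x : (0 <= k x)%R by rewrite mulr_ge0 ?expR_ge0// invr_ge0 ltW.
have mk : measurable_fun setT k by exact: (measurable_power_expR 1 (f := fun=> z)).
have mE i : measurable (E i).
  by rewrite /E; case: ifP => // _; exact: measurable_positives.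
transitivity (\int[lebesgue_tuple R d]_s
    (\prod_(i < d) (k \_ (E i)) (tnth s i))%:E).
  rewrite integral_mkcond; apply: eq_integral => s _.
  rewrite patchE; case: ifPn => [/set_mem[sD sA]|].
    rewrite scaled_exponential_score; congr (_ %:E); apply: eq_bigr => i _.
    rewrite patchE mem_set// /E; case: eqP => [->|_]; first exact: sA.
    exact: sD.
  rewrite notin_setE => sDA.
  (* Outside the domain some coordinate leaves its set [E i], and its zero factor kills the product.
     Since [A] lies in (0, oo), [E j] also encodes positivity of coordinate [j]. *)
  have [i nEi] : exists i, ~ E i (tnth s i).
    apply: contrapT => /forallNP nE; apply: sDA; split => /=.
      move=> i; have /contrapT := nE i; rewrite /E; case: eqP => [_|//].
      exact: AD.
    by have /contrapT := nE j; rewrite /E eqxx.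
  by rewrite (bigD1 i)//= patchE memNset// mul0r.
rewrite (@integral_power_measure_prod _ _ _ _ _ (fun i => k \_ (E i))); last 2 first.
- move=> i; apply: (measurable_restrictT _ (mE i)).1.
  exact: measurable_funTS.
- by move=> i x; rewrite patchE; case: ifP.
have kE i : \int[lebesgue_measure]_x ((k \_ (E i)) x)%:E =
    \int[lebesgue_measure]_(x in E i) (k x)%:E.
  rewrite [RHS]integral_mkcond; apply: eq_integral => x _.
  by rewrite !patchE; case: ifP.
rewrite (bigD1 j)//= big1 ?mule1; first by rewrite kE /E eqxx.
move=> i ij; rewrite kE /E (negbTE ij); exact: integral_exponential_kernel.
Qed.

End exponential_score.

(** * Marginals, joint density and the derivative formula *)

(** If [alpha] vanishes, the Lévy condition does not constrain [rho] and f may be infinite, hence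
    the guard on the last part. Finiteness and derivability are asserted because [fine] and
    [derive1n] are total and would return default values. *)
Theorem theorem4 (R : realType) (X : polishType R) (d : nat) (d_ge1 : (1 <= d)%N)
    (rho : {measure set (measurableTypeR R) -> \bar R})
    (alpha : {measure set (borel X) -> \bar R})
    (nustar : {measure set (measurableTypeR R * borel X) -> \bar R})
    (nustar_levy : levy_intensity nustar)
    (nustar_homogeneous : product_form (@positives R) nustar rho alpha) :
  let h := @exponential_score R d in
  let f := exponential_marginal rho in
  [/\ forall j : 'I_d,
        product_form (@positives R) (marginal j (corm_intensity h nustar))
          (fun B => \int[lebesgue_measure]_(s in B) f s)%E alpha,
      product_form (@positive_tuples R d) (corm_intensity h nustar)
        (fun S => \int[lebesgue_tuple R d]_(s in S) corm_density h rho s)%E alpha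
    & alpha setT != 0%E ->
      [/\ forall s : R, 0 < s -> f s \is a fin_num,
          forall (k : nat) (s : R), (k < d.-1)%N -> 0 < s ->
            derivable (derive1n k (fine \o f)) s 1
        & forall s : d.-tuple R, positive_tuples s ->
            corm_density h rho s =
            ((-1) ^+ d.-1 *
              derive1n d.-1 (fine \o f) (\sum_(i < d) tnth s i))%:E]].
Proof.
move=> h f; have mh := @measurable_exponential_score R d.
have h0 := @exponential_score_ge0 R d.
have mD := @measurable_positives R.
have mP := @measurable_positive_tuples R d.
have mk : measurable_fun setT
    (fun p : measurableTypeR R * measurableTypeR R =>
      ((p.1 : R)^-1 * expR (- (p.2 : R) / p.1))%:E).
  by apply/measurable_EFinP; exact: (measurable_power_expR 1).
have aB0 (B : set (borel X)) : measurable B -> alpha B != 0%E -> alpha setT != 0%E.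
  move=> mB; apply: contra => /eqP aT; rewrite -measure_le0 -aT.
  by rewrite le_measure// inE.
(* When alpha B = 0, rho need not be sigma-finite, but both sides vanish. *)
split.
- move=> j A B mA AD mB; rewrite /marginal /pushforward.
  have mS : measurable ((@tnth d (measurableTypeR R))^~ j @^-1` A).
    by rewrite -[X in measurable X]setTI; exact: (measurable_tnth j measurableT mA).
  rewrite (_ : _ @^-1` (A `*` B) =
      ((@tnth d (measurableTypeR R))^~ j @^-1` A) `*` B)//.
  rewrite (corm_intensity_setX mh h0 nustar_homogeneous mS mB).
  have [->|aB] := eqVneq (alpha B) 0%E; first by rewrite !mule0.
  congr (_ * _)%E.
  have sf := levy_sigma_finite nustar_levy nustar_homogeneous (aB0 _ mB aB).
  rewrite (eq_integral (fun z : measurableTypeR R => \int[lebesgue_measure]_(x in A)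
      ((z : R)^-1 * expR (- (x : R) / z))%:E)%E); last first.
    by move=> z /set_mem Dz; exact: integral_exponential_score_coordinate.
  (* Only the kernel in coordinate [j] is left; exchanging [rho] and Lebesgue measure turns it into
     f integrated over [A]. *)
  rewrite (tonelli_sigma_finite (@lebesgue_measure R) mD mA sf
    (f := fun p : measurableTypeR R * measurableTypeR R =>
      ((p.1 : R)^-1 * expR (- (p.2 : R) / p.1))%:E))//.
  + exact: measurable_funTS.
  + move=> p [/positives_gt0 p0 _].
    by rewrite lee_fin mulr_ge0 ?expR_ge0// invr_ge0 ltW.
- move=> A B mA AP mB.
  rewrite (corm_intensity_setX mh h0 nustar_homogeneous mA mB) setIidr//.
  have [->|aB] := eqVneq (alpha B) 0%E; first by rewrite !mule0.
  congr (_ * _)%E.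
  have sf := levy_sigma_finite nustar_levy nustar_homogeneous (aB0 _ mB aB).
  rewrite (tonelli_sigma_finite (lebesgue_tuple R d) mD mA sf
    (f := fun p : measurableTypeR R * d.-tuple (measurableTypeR R) =>
      (scaled_score h p.1 p.2)%:E))//.
  + by apply: measurable_funTS; exact: measurable_scaled_score.
  + by move=> p [Dp _]; exact: scaled_score_ge0.
move=> aT.
have rho_int (n : nat) (s : R) (s0 : 0 < s) :=
  integrable_power_expR nustar_levy nustar_homogeneous aT n s0.
(* The exponent 1 places f in the family z^-n e^(-s/z) at n = 1, so that d - 1 derivatives lead to n
   = d. *)
have fE : fine \o f = (fun s : R =>
    \int[rho]_(z in @positives R) ((z : R)^-1 ^+ 1 * expR (- s / z))).
  by apply/funext => s /=; rewrite /f /exponential_marginal /Rintegral.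
split.
- move=> s s0; exact: (integrable_fin_num mD (rho_int 1%N s s0)).
- move=> k s _ s0; rewrite fE.
  exact: (derivable_Rintegral_power_expR rho_int).
- move=> s sP; have s0 : 0 < \sum_(i < d) tnth s i.
    (* Since [d] is at least 1 there is a first coordinate, whose strict positivity makes the whole
       sum positive. *)
    rewrite -(prednK d_ge1) in s sP *; rewrite big_ord_recl.
    rewrite ltr_wpDr//; last exact/positives_gt0/sP.
    by apply: sumr_ge0 => i _; apply/ltW/positives_gt0/sP.
  (* The two factors (-1)^(d-1) cancel, and 1 + (d - 1) = d. *)
  rewrite fE (derive1n_Rintegral_power_expR rho_int)// mulrA -exprMn.
  rewrite mulrNN mulr1 expr1n mul1r add1n prednK//.
  rewrite /corm_density /Rintegral fineK; last first.
    exact: (integrable_fin_num mD (rho_int d _ s0)).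
  by apply: eq_integral => z _; rewrite scaled_exponential_score_sum.
Qed.
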